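(* Let $k\in\mathbb N$ and let $D(k)\subset P(k)$ be a collection of partitions. For $n$ sufficiently large, the Gram matrix $G_{kn}=(n^{|\pi\vee\sigma|})_{\pi,\sigma\in D(k)}$ is invertible. Moreover, the entries of the Weingarten matrix $W_{kn}=G_{kn}^{-1}$ satisfy the following as $n\to\infty$: (1) $W_{kn}(\pi,\sigma)=O\big(n^{|\pi\vee\sigma|-|\pi|-|\sigma|}\big)$ for $\pi,\sigma\in D(k)$. (2) If $\pi,\sigma\in D(k)$ and $\pi\le\sigma$, then $$n^{|\pi|}W_{kn}(\pi,\sigma)=\mu_{D(k)}(\pi,\sigma)+O(n^{-1}),$$ where $\mu_{D(k)}$ is the Möbius function of the partially ordered set $D(k)$ under the restriction of the order on $P(k)$.
   Context: $P(k)$ is the set of partitions of $\{1,\dots,k\}$, ordered by $\pi\le\sigma$ iff each block of $\pi$ is contained in a block of $\sigma$. $|\pi|$ is the number of blocks of $\pi$, and $\pi\vee\sigma$ is the join in $P(k)$ (the least element of $P(k)$ that is $\geq$ both $\pi$ and $\sigma$; it need not belong to $D(k)$). For a finite poset $Q$ the Möbius function $\mu_Q:Q\times Q\to\mathbb Z$ is $\mu_Q(p,q)=0$ if $p\not\le q$, $\mu_Q(p,p)=1$, and for $p<q$ $$\mu_Q(p,q)=-1+\sum_{l\ge1}(-1)^{l+1}\#\{(p_1,\dots,p_l)\in Q^l: p<p_1<\cdots<p_l<q\}.$$ *)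

(* Defs.v *)
From HB Require Import structures.
From mathcomp Require Import all_boot all_order all_algebra.

Set Implicit Arguments.
Unset Strict Implicit.
Unset Printing Implicit Defensive.

Import Order.TTheory GRing.Theory Num.Theory.

Local Open Scope ring_scope.

(* The blocks are the members of the underlying set of sets; [partition]
   requires them to be nonempty. *)
Definition setpart (k : nat) :=
  {P : {set {set 'I_k}} | partition P [set: 'I_k]}.

HB.instance Definition _ k := Finite.on (setpart k).

Definition nblocks k (P : setpart k) : nat := #|val P|.

Section SetPartOrder.
Variable k : nat.
Implicit Types P Q S : setpart k.

Definition refines P Q : bool :=
  [forall B in val P, [exists C in val Q, B \subset C]].

Lemma cover_setpart P : cover (val P) = [set: 'I_k].
Proof. by case: P => P /= /and3P[/eqP]. Qed.

Lemma trivIset_setpart P : trivIset (val P).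
Proof. by case: P => P /= /and3P[]. Qed.

Lemma mem_pblock_setpart P x : x \in pblock (val P) x.
Proof. by rewrite mem_pblock cover_setpart in_setT. Qed.

Lemma pblock_mem_setpart P x : pblock (val P) x \in val P.
Proof. by apply: pblock_mem; rewrite cover_setpart in_setT. Qed.

Lemma eq_pblock_setpart P x y :
  (pblock (val P) x == pblock (val P) y) = (y \in pblock (val P) x).
Proof.
by rewrite eq_pblock ?trivIset_setpart // cover_setpart in_setT.
Qed.

Lemma block_setpart P B : B \in val P -> exists2 x, x \in B & B = pblock (val P) x.
Proof.
move=> BP; have [B0|[x xB]] := set_0Vmem B.
  by case: (P) BP => p /= /and3P[_ _ /negP p0]; rewrite B0.
by exists x => //; rewrite (def_pblock (trivIset_setpart P) BP xB).
Qed.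

Lemma refinesP P Q :
  reflect (forall x y, y \in pblock (val P) x -> y \in pblock (val Q) x)
          (refines P Q).
Proof.
apply: (iffP forall_inP) => [PQ x y yP|PQ B BP].
  have /exists_inP[C CQ /subsetP sC] := PQ _ (pblock_mem_setpart P x).
  have xC := sC _ (mem_pblock_setpart P x).
  by rewrite (def_pblock (trivIset_setpart Q) CQ xC) sC.
have [x xB ->] := block_setpart BP.
apply/exists_inP; exists (pblock (val Q) x); first exact: pblock_mem_setpart.
by apply/subsetP => y /PQ.
Qed.

Fact refines_refl : reflexive refines.
Proof. by move=> P; apply/refinesP. Qed.

Fact refines_trans : transitive refines.
Proof.
by move=> Q P S /refinesP PQ /refinesP QS; apply/refinesP => x y /PQ/QS.
Qed.

Fact refines_anti : antisymmetric refines.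
Proof.
move=> P Q /andP[/refinesP PQ /refinesP QP].
have E x : pblock (val P) x = pblock (val Q) x.
  by apply/setP => y; apply/idP/idP => [/PQ|/QP].
apply/val_inj/setP => B; apply/idP/idP => /block_setpart[x _ ->].
  by rewrite E pblock_mem_setpart.
by rewrite -E pblock_mem_setpart.
Qed.

Definition linked P Q : rel 'I_k :=
  fun x y => (y \in pblock (val P) x) || (y \in pblock (val Q) x).

Lemma linked_connect_equiv P Q :
  {in [set: 'I_k] & &, equivalence_rel (connect (linked P Q))}.
Proof.
have sym : connect_sym (linked P Q).
  apply: sym_connect_sym => x y.
  by rewrite /linked -!eq_pblock_setpart ![pblock _ x == _]eq_sym.
move=> x y z _ _ _; split=> [|xy]; first exact: connect0.
by rewrite (same_connect sym xy).
Qed.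

Fact join_subproof P Q :
  partition (equivalence_partition (connect (linked P Q)) [set: 'I_k])
            [set: 'I_k].
Proof. exact: equivalence_partitionP (@linked_connect_equiv P Q). Qed.

Definition join_setpart P Q : setpart k :=
  Sub (equivalence_partition (connect (linked P Q)) [set: 'I_k]) (join_subproof P Q).

Fact join_setpart_le P Q S :
  refines (join_setpart P Q) S = refines P S && refines Q S.
Proof.
have pJ x y : (y \in pblock (val (join_setpart P Q)) x)
    = connect (linked P Q) x y.
  exact: (pblock_equivalence_partition (@linked_connect_equiv P Q)).
apply/refinesP/andP => [JS|[/refinesP PS /refinesP QS] x y].
  by split; apply/refinesP => x y xy; apply: JS; rewrite pJ;
    apply: connect1; rewrite /linked xy ?orbT.
rewrite pJ => /connectP[p].
elim: p x => [x _ ->|z p IHp x /= /andP[xz zp] yE].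
  exact: mem_pblock_setpart.
have xzS : z \in pblock (val S) x by case/orP: xz => [/PS|/QS].
have := IHp z zp yE; rewrite -!eq_pblock_setpart in xzS *.
by rewrite (eqP xzS).
Qed.

Fact setpart_display : Order.disp_t. Proof. exact: (Order.Disp tt tt). Qed.

HB.instance Definition _ := Order.Le_isPOrder.Build setpart_display (setpart k)
  refines_refl refines_anti refines_trans.

(* Thus [P `|` Q] is the least element of [setpart k] above [P] and [Q]. *)
HB.instance Definition _ := Order.POrder_isJoinSemilattice.Build
  setpart_display (setpart k) join_setpart_le.

End SetPartOrder.

(* A subset of a finite poset, as a poset under the restricted order. *)
Definition subposet d (Q : finPOrderType d) (D : {set Q}) := {x : Q | x \in D}.

HB.instance Definition _ d (Q : finPOrderType d) (D : {set Q}) :=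
  SubFinite.on (subposet D).
HB.instance Definition _ d (Q : finPOrderType d) (D : {set Q}) :=
  [SubChoice_isSubPOrder of subposet D by <: with d].

(* Chains in [Q] have length at most #|Q|, so the sum over all l >= 1 may be
   cut there. *)
Definition moebius d (Q : finPOrderType d) (p q : Q) : int :=
  if ~~ (p <= q)%O then 0
  else if p == q then 1
  else -1 + \sum_(1 <= l < #|Q|.+1)
    (-1) ^+ l.+1 * #|[set t : l.-tuple Q | path <%O p (rcons t q)]|%:Z.

Section Weingarten.
Variables (R : realFieldType) (k : nat) (D : {set setpart k}) (n : nat).

(* Rows and columns are numbered through the enumeration of [subposet D]. *)
Definition gram : 'M[R]_#|{: subposet D}| :=
  \matrix_(i, j)
    n%:R ^+ nblocks (val (enum_val i) `|` val (enum_val j))%O.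

(* [invmx] is the inverse only when [gram \in unitmx]. *)
Definition weingarten (p q : subposet D) : R :=
  invmx gram (enum_rank p) (enum_rank q).

End Weingarten.

(* Main.v *)
Require Import Defs.
From mathcomp Require Import all_boot all_order all_algebra zify.
Import Order.TTheory GRing.Theory Num.Theory.

Set Implicit Arguments.
Unset Strict Implicit.
Unset Printing Implicit Defensive.

Local Open Scope ring_scope.

(** Write [b p] for the number of blocks of [p], and put [t = 1/n].  Dividing
column [q] of the Gram matrix by [n ^ b q] leaves the entries
[t ^ (b q - b (p `|` q))], polynomials in [t] whose value at [t = 0] is 1 when
[p <= q] and 0 otherwise.  At [t = 0] the matrix is therefore the zeta matrix
of the poset [D], whose inverse is the Moebius matrix ([zeta_mul_moebius]).
So the determinant, a polynomial in [t], does not vanish at 0.  The Gram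
matrix is thus invertible for large [n], and by Cramer's rule
[n ^ b p * W(p, q)] is a quotient of two polynomials in [t], with value
[moebius p q] at [t = 0]; it differs from that value by O(t).

For the decay of [W], rescale rows and columns further, by the powers
[n ^ - phi p] and [n ^ phi q] of a weight [phi].  As long as the exponents of
[t] stay nonnegative ([admissible]) the entries are still polynomials in [t].
The further rescaling is a conjugation by a diagonal matrix, so it does not
change the determinant ([det_scaled_gram]), and the entries of the inverse of
the rescaled matrix are again bounded.  For a fixed [r] the weight
[phi p = b (p `|` r)] is admissible: this is the inequality
[b (p `|` q) + b (q `|` r) <= b q + b (p `|` r)] ([nblocks_semimod]).
Undoing the rescaling in column [r] gives exactly
[W(p, r) = O(n ^ (b (p `|` r) - b p - b r))].

The inequality on blocks is linear algebra.  The vectors indexed by ['I_k]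
that are constant on the blocks of [p] form a space of dimension [b p].  These
spaces are ordered by reverse inclusion, and a join gives an intersection, so
that the inequality compares the dimensions of a sum and an intersection of
two spaces. *)

(** * Partitions as spaces of blockwise constant vectors *)

Section BlockSpace.
Variable k : nat.
Implicit Types P Q S : setpart k.

(** The rows are the indicators of the blocks: the row space consists of the
vectors that are constant on each block. *)
Definition blockmx P : 'M[rat]_(nblocks P, k) :=
  \matrix_(i, x) (x \in (enum_val i : {set _}))%:R.

Lemma mem_block P (B : {set 'I_k}) x : B \in val P ->
  (x \in B) = (B == pblock (val P) x).
Proof.
move=> BP; apply/idP/eqP => [xB|->]; last exact: mem_pblock_setpart.
by rewrite (def_pblock (trivIset_setpart P) BP xB).
Qed.

Lemma mul_blockmx P (w : 'rV_(nblocks P)) (i : 'I_(nblocks P)) x :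
  x \in (enum_val i : {set _}) -> (w *m blockmx P) 0 x = w 0 i.
Proof.
move=> xi; rewrite mxE (bigD1 i) //= big1 => [|j ji]; rewrite mxE.
  by rewrite xi mulr1 addr0.
move: xi; rewrite !(mem_block _ (enum_valP _)) => /eqP <-.
by rewrite (inj_eq enum_val_inj) (negPf ji) mulr0.
Qed.

Lemma mxrank_blockmx P : \rank (blockmx P) = nblocks P.
Proof.
apply/eqP; rewrite -[_ == _]/(row_free _) -kermx_eq0; apply/rowV0P => w.
move/sub_kermxP => w0; apply/rowP => i.
have [x xi _] := block_setpart (enum_valP i).
by rewrite -(mul_blockmx w xi) w0 !mxE.
Qed.

Lemma sub_blockmxP P (u : 'rV_k) :
  reflect (forall x y, y \in pblock (val P) x -> u 0 x = u 0 y)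
          (u <= blockmx P)%MS.
Proof.
have blk x : {i : 'I_(nblocks P) | enum_val i = pblock (val P) x}.
  by exists (enum_rank_in (pblock_mem_setpart P x) (pblock (val P) x));
    rewrite enum_rankK_in ?pblock_mem_setpart.
apply: (iffP submxP) => [[w ->] x y|cu].
  have [i ix] := blk x; rewrite -ix => yi.
  by rewrite !(mul_blockmx w (i := i)) // ix mem_pblock_setpart.
exists (\row_(i < nblocks P) if [pick x in (enum_val i : {set _})] is Some x then u 0 x else 0).
apply/rowP => x; have [i ix] := blk x.
rewrite (mul_blockmx _ (i := i)) ?ix ?mem_pblock_setpart // mxE.
case: pickP => [y|/(_ x)]; rewrite ix; first exact: cu.
by rewrite mem_pblock_setpart.
Qed.

(** A partition is recovered from its space, so [refines] is the reverse
inclusion of row spaces: the indicator of a block of [Q] is constant on the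
blocks of [P] exactly when that block is a union of blocks of [P]. *)
Lemma blockmxS P Q : (blockmx Q <= blockmx P)%MS = (P <= Q)%O.
Proof.
apply/row_subP/refinesP => [sQP x y xy|PQ i].
  pose i : 'I_(nblocks Q) :=
    enum_rank_in (pblock_mem_setpart Q x) (pblock (val Q) x).
  have ix : enum_val i = pblock (val Q) x.
    by rewrite enum_rankK_in ?pblock_mem_setpart.
  have /sub_blockmxP/(_ x y xy) := sQP i.
  by rewrite !mxE ix mem_pblock_setpart; case: (y \in _).
apply/sub_blockmxP => x y /PQ xy; rewrite !mxE !(mem_block _ (enum_valP i)).
by move: xy; rewrite -eq_pblock_setpart => /eqP->.
Qed.

(** A vector constant on the blocks of both partitions is constant on the
blocks of their join, because its level sets form a partition coarser than
both. *)
Lemma blockmx_cap P Q :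
  (blockmx P :&: blockmx Q <= blockmx (P `|` Q)%O)%MS.
Proof.
apply/rV_subP => u; rewrite sub_capmx => /andP[/sub_blockmxP uP /sub_blockmxP uQ].
pose f x := u 0 x.
have part : partition (preim_partition f [set: 'I_k]) [set: 'I_k].
  exact: preim_partitionP.
pose K : setpart k := Sub (preim_partition f [set: _]) part.
have KE x y : (y \in pblock (val K) x) = (f x == f y).
  apply: pblock_equivalence_partition; rewrite ?inE //.
  by move=> a b c _ _ _; split=> // /eqP->.
have PQK : (P `|` Q <= K)%O.
  by rewrite leUx; apply/andP; split; apply/refinesP => x y xy;
    rewrite KE; apply/eqP; [apply: uP|apply: uQ].
by apply/sub_blockmxP => x y /(refinesP _ _ PQK); rewrite KE => /eqP.
Qed.

Lemma nblocks_le P Q : (P <= Q)%O -> (nblocks Q <= nblocks P)%N.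
Proof. by rewrite -blockmxS => /mxrankS; rewrite !mxrank_blockmx. Qed.

Lemma nblocks_inj_le P Q : (P <= Q)%O -> nblocks P = nblocks Q -> P = Q.
Proof.
move=> PQ ePQ; apply/eqP; rewrite eq_le PQ -blockmxS /=.
move: PQ; rewrite -blockmxS => /mxrank_leqif_sup[_ <-].
by rewrite !mxrank_blockmx ePQ.
Qed.

(** The spaces of [P `|` Q] and [Q `|` S] both lie in that of [Q], hence so does
their sum, and their intersection lies in the space of [P `|` S]. *)
Lemma nblocks_semimod P Q S :
  (nblocks (P `|` Q)%O + nblocks (Q `|` S)%O <= nblocks Q + nblocks (P `|` S)%O)%N.
Proof.
rewrite -(mxrank_blockmx (P `|` Q)%O) -(mxrank_blockmx (Q `|` S)%O).
rewrite -mxrank_sum_cap -(mxrank_blockmx Q) -(mxrank_blockmx (P `|` S)%O).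
apply: leq_add; apply: mxrankS.
  by rewrite addsmx_sub !blockmxS leUr leUl.
apply: submx_trans (blockmx_cap _ _) _.
by rewrite blockmxS leU2 ?leUl ?leUr.
Qed.

End BlockSpace.

(** * The Moebius function inverts the zeta function *)

Section Moebius.
Variables (d : Order.disp_t) (Q : finPOrderType d).
Implicit Types p q r : Q.

Definition nchains l p r : int :=
  #|[set t : l.-tuple Q | path <%O p (rcons t r)]|%:Z.

Lemma nchains0 p r : nchains 0 p r = (p < r)%O%:R.
Proof.
rewrite /nchains; case: (boolP (p < r)%O) => [pr|/negPf pr].
  rewrite (_ : [set _ | _] = setT) ?cardsT ?card_tuple //.
  by apply/setP => t; rewrite (tuple0 t) !inE /= pr.
rewrite (_ : [set _ | _] = set0) ?cards0 //.
by apply/setP => t; rewrite (tuple0 t) !inE /= pr.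
Qed.

Lemma nchainsS l p r : nchains l.+1 p r = \sum_(q | (p < q)%O) nchains l q r.
Proof.
rewrite /nchains -natz; under eq_bigr do rewrite -natz.
rewrite -natr_sum; congr (_%:R).
rewrite -sum1_card (reindex (fun u : Q * l.-tuple Q => cons_tuple u.1 u.2)) /=.
  under [RHS]eq_bigr do rewrite -sum1_card.
  by rewrite pair_big_dep; apply: eq_bigl => -[q t] /=; rewrite !inE.
exists (fun t => (thead t, behead_tuple t)) => [[q t]|t] _ /=.
  by congr pair; apply/val_inj.
by rewrite [RHS]tuple_eta; apply/val_inj.
Qed.

(** The points of a chain, endpoints included, are distinct, so there are at
most [#|Q|] of them. *)
Lemma nchains_eq0 l p r : ~~ (p < r)%O || (#|Q| <= l)%N -> nchains l p r = 0.
Proof.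
move=> lpr; rewrite /nchains (_ : [set _ | _] = set0) ?cards0 //.
apply/setP => t; rewrite !inE; apply/negP => pt.
case/orP: lpr => [/negP[]|lQ].
  have /allP := order_path_min lt_trans pt.
  by apply; rewrite mem_rcons mem_head.
have st : sorted <%O (p :: rcons t r) by [].
have /card_uniqP ut := sorted_uniq lt_trans ltxx st.
have := max_card (mem (p :: rcons t r)).
by rewrite ut /= size_rcons size_tuple leqNgt ltnS leqW.
Qed.

(** In this form the empty chain accounts for the term -1, and the three cases
of the definition of [moebius] are treated alike. *)
Lemma moebiusE p r : moebius p r =
  (p == r)%:R + \sum_(0 <= l < #|Q|.+1) (-1) ^+ l.+1 * nchains l p r.
Proof.
rewrite /moebius; case: (boolP (p <= r)%O) => [|npr] /=; last first.
  rewrite big1 ?addr0 => [|l _].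
    by case: eqP npr => // ->; rewrite lexx.
  by rewrite nchains_eq0 ?mulr0 // (contra (@ltW _ _ _ _) npr).
rewrite le_eqVlt; case: eqP => [->|_] /= pr.
  by rewrite big1 ?addr0 // => l _; rewrite nchains_eq0 ?mulr0 // ltxx.
by rewrite add0r [RHS]big_nat_recl // nchains0 pr expr1 mulr1 big_add1.
Qed.

(** If [A] is the strict order relation as a matrix, [nchains l] is
[A ^ (l + 1)] by [nchainsS], so that [moebiusE] expands [moebius] as the
geometric series of [(1 + A)^-1], with [1 + A] the zeta matrix. *)
Lemma zeta_mul_moebius p r :
  \sum_(q | (p <= q)%O) moebius q r = (p == r)%:R.
Proof.
have lt_sum : \sum_(q | (p < q)%O) moebius q r = (p == r)%:R - moebius p r.
  under eq_bigr do rewrite moebiusE.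
  rewrite big_split /= exchange_big /=.
  have -> : \sum_(q | (p < q)%O) (q == r)%:R = nchains 0 p r.
    rewrite nchains0 big_mkcond (bigD1 r) //= eqxx big1 ?addr0 => [|q /negPf->].
      by case: ifP.
    by case: ifP.
  rewrite moebiusE opprD addrA subrr add0r [in RHS]big_nat_recl //=.
  rewrite expr1 mulN1r opprD opprK; congr (_ + _).
  (* The last summand would count chains with [#|Q|] interior points. *)
  rewrite big_nat_recr //= [X in _ + X]big1 => [|q _]; last first.
    by rewrite nchains_eq0 ?mulr0 // leqnn orbT.
  rewrite addr0 -sumrN; apply: eq_bigr => l _.
  by rewrite -mulr_sumr -nchainsS [in RHS]exprS mulN1r mulNr opprK.
rewrite (bigD1 p) //= (eq_bigl (fun q => (p < q)%O)) => [|q].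
  by rewrite lt_sum addrC subrK.
by rewrite lt_def andbC.
Qed.

End Moebius.

(** * The rescaled Gram matrix as a polynomial matrix *)

Lemma invmx_rescale (F : fieldType) m (G M : 'M[F]_m) (x y : 'I_m -> F) :
    (forall i, x i != 0) -> (forall i, y i != 0) ->
    (forall i j, G i j = x i * M i j * y j) -> M \in unitmx ->
  G \in unitmx /\ forall i j, invmx G i j = (y i)^-1 * invmx M i j * (x j)^-1.
Proof.
move=> x0 y0 GE Mu.
pose W : 'M[F]_m := \matrix_(i, j) ((y i)^-1 * invmx M i j * (x j)^-1).
have GW : G *m W = 1%:M.
  apply/matrixP => i j; rewrite mxE.
  transitivity (x i * (M *m invmx M) i j * (x j)^-1).
    rewrite mxE mulr_sumr mulr_suml; apply: eq_bigr => l _.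
    by rewrite GE [W l j]mxE !mulrA mulfK.
  rewrite mulmxV // mxE.
  by case: eqP => [->|]; rewrite ?mulr1 ?mulr0 ?mul0r ?divff.
have [Gu _] := mulmx1_unit GW; split=> // i j.
by rewrite -[invmx G]mulmx1 -GW mulKmx // mxE.
Qed.

Section ScaledGram.
Variables (R : realFieldType) (k : nat) (D : {set setpart k}).
Implicit Types p q r : subposet D.

Local Notation m := #|{: subposet D}|.
Local Notation bl p := (nblocks (val p)).
Local Notation jn p q := (nblocks (val p `|` val q)%O).

(** The rescaled Gram matrix as a polynomial matrix in [t = 1/n]; the natural
subtraction is a true one when [phi] is [admissible]. *)
Definition scaled_gram (phi : subposet D -> nat) : 'M[{poly R}]_m :=
  \matrix_(i, j) 'X^(bl (enum_val j) + phi (enum_val i)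
                     - (jn (enum_val i) (enum_val j) + phi (enum_val j))).

Definition admissible (phi : subposet D -> nat) :=
  forall p q, (jn p q + phi q <= bl q + phi p)%N.

Definition zetamx : 'M[R]_m :=
  \matrix_(i, j) (enum_val i <= enum_val j)%O%:R.

Definition moebiusmx : 'M[R]_m :=
  \matrix_(i, j) (moebius (enum_val i) (enum_val j))%:~R.

Lemma mul_zetamx_moebiusmx : zetamx *m moebiusmx = 1%:M.
Proof.
apply/matrixP => i j; rewrite !mxE.
transitivity ((\sum_(q | (enum_val i <= q)%O) moebius q (enum_val j))%:~R : R).
  rewrite rmorph_sum [RHS]big_mkcond [RHS](reindex (@enum_val _ {: subposet D})) /=.
    by apply: eq_bigr => l _; rewrite !mxE; case: ifP; rewrite (mul1r, mul0r).
  by apply: onW_bij; apply: enum_val_bij.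
by rewrite zeta_mul_moebius (inj_eq enum_val_inj); case: (i == j).
Qed.

Lemma admissible0 : admissible (fun=> 0%N).
Proof. by move=> p q; rewrite !addn0 nblocks_le ?leUr. Qed.

Lemma admissible_join r : admissible (fun p => jn p r).
Proof. by move=> p q; apply: nblocks_semimod. Qed.

(** Only the entries with exponent 0 survive at [t = 0], and
[b q = b (p `|` q)] forces [q = p `|` q] since [q <= p `|` q]. *)
Lemma scaled_gram0_eval :
  map_mx (horner_eval 0) (scaled_gram (fun=> 0%N)) = zetamx.
Proof.
apply/matrixP => i j; rewrite !mxE horner_evalE hornerXn !addn0 expr0n.
set p := enum_val i; set q := enum_val j.
congr (nat_of_bool _)%:R; rewrite subn_eq0 -[RHS]/(val p <= val q)%O leEjoin.
have qJ : (val q <= val p `|` val q)%O by rewrite leUr.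
apply/idP/eqP => [le_qJ|->//].
by apply/esym/(nblocks_inj_le qJ)/eqP; rewrite eqn_leq le_qJ nblocks_le.
Qed.

(** The diagonal matrix with entries ['X^(phi p)] intertwines the two matrices.
It is not invertible over {poly R}, but its determinant is nonzero and
therefore cancels. *)
Lemma det_scaled_gram phi : admissible phi ->
  \det (scaled_gram phi) = \det (scaled_gram (fun=> 0%N)).
Proof.
move=> phiP; pose Y : 'M[{poly R}]_m := diag_mx (\row_i 'X^(phi (enum_val i))).
have YE : scaled_gram phi *m Y = Y *m scaled_gram (fun=> 0%N).
  apply/matrixP => i j; rewrite mul_mx_diag mul_diag_mx !mxE -!exprD !addn0.
  have expE (a b f g : nat) : (a <= b -> a + g <= b + f ->
    b + f - (a + g) + g = f + (b - a))%N by lia.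
  congr (_ ^+ _); apply: expE (phiP _ _).
  by have := admissible0 (enum_val i) (enum_val j); rewrite !addn0.
have Y0 : \det Y != 0.
  by rewrite det_diag prodf_seq_neq0; apply/allP => i _; rewrite mxE expf_neq0 ?polyX_eq0.
by apply: (mulIf Y0); rewrite -det_mulmx YE det_mulmx mulrC.
Qed.

Lemma det_scaled_gram_neq0 phi : admissible phi ->
  (\det (scaled_gram phi)).[0] != 0.
Proof.
move=> /det_scaled_gram->.
rewrite -horner_evalE -det_map_mx scaled_gram0_eval.
apply/negP => /eqP d0; have /eqP := congr1 (fun M => \det M) mul_zetamx_moebiusmx.
by rewrite det_mulmx d0 mul0r det1 eq_sym oner_eq0.
Qed.

(** Cramer's rule for the zeta matrix, with evaluation at 0 as a ring morphism. *)
Lemma adj_scaled_gram0_eval p q :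
  (\adj (scaled_gram (fun=> 0%N)) (enum_rank p) (enum_rank q)).[0]
  = (moebius p q)%:~R * (\det (scaled_gram (fun=> 0%N))).[0].
Proof.
rewrite -!horner_evalE -det_map_mx scaled_gram0_eval.
transitivity (\adj zetamx (enum_rank p) (enum_rank q)).
  by rewrite -scaled_gram0_eval -map_mx_adj [RHS]mxE.
have -> : \adj zetamx = \det zetamx *: moebiusmx.
  by rewrite -[LHS]mulmx1 -mul_zetamx_moebiusmx mulmxA mul_adj_mx mul_scalar_mx.
by rewrite !mxE !enum_rankK mulrC.
Qed.

Lemma gramE phi n i j : admissible phi -> (0 < n)%N ->
  gram R D n i j = n%:R ^+ phi (enum_val i) * (scaled_gram phi i j).[n%:R^-1]
    * (n%:R ^+ bl (enum_val j) / n%:R ^+ phi (enum_val j)).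
Proof.
move=> phiP n0; rewrite !mxE hornerXn exprVn.
have n0' : n%:R != 0 :> R by rewrite pnatr_eq0 -lt0n.
set e := (_ - _)%N; set f := phi _; set a := nblocks _; set g := phi _.
set b := nblocks _.
have E : n%:R ^+ f * n%:R ^+ b = n%:R ^+ a * (n%:R ^+ e * n%:R ^+ g) :> R.
  rewrite -!exprD addnCA addnC -(subnK (phiP (enum_val i) (enum_val j))).
  by rewrite addnA.
have eg0 : n%:R ^+ e * n%:R ^+ g != 0 :> R by rewrite mulf_neq0 ?expf_neq0.
by rewrite -[LHS](mulfK eg0) -E invfM mulrACA.
Qed.

Lemma weingartenE phi n : admissible phi -> (0 < n)%N ->
    (\det (scaled_gram phi)).[n%:R^-1] != 0 ->
  gram R D n \in unitmx /\
  forall p q, weingarten R n p q = n%:R ^+ phi p / n%:R ^+ bl p / n%:R ^+ phi q *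
    ((\adj (scaled_gram phi) (enum_rank p) (enum_rank q)).[n%:R^-1]
     / (\det (scaled_gram phi)).[n%:R^-1]).
Proof.
move=> phiP n0 d0.
have n0' : n%:R != 0 :> R by rewrite pnatr_eq0 -lt0n.
pose M := map_mx (horner_eval (n%:R^-1 : R)) (scaled_gram phi).
have detM : \det M = (\det (scaled_gram phi)).[n%:R^-1] by rewrite det_map_mx.
have Mu : M \in unitmx by rewrite unitmxE detM unitfE.
have [|||Gu GV] := @invmx_rescale _ _ (gram R D n) M
  (fun i => n%:R ^+ phi (enum_val i))
  (fun i => n%:R ^+ bl (enum_val i) / n%:R ^+ phi (enum_val i)) _ _ _ Mu.
- by move=> i; rewrite expf_neq0.
- by move=> i; rewrite mulf_neq0 ?invr_eq0 ?expf_neq0.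
- by move=> i j; rewrite (gramE _ _ phiP n0) [M i j]mxE.
split=> // p q; rewrite /weingarten GV !enum_rankK /invmx Mu detM.
rewrite [in LHS]mxE -map_mx_adj [in LHS]mxE.
by rewrite invf_div mulrAC [X in _ * X]mulrC.
Qed.

End ScaledGram.

(** * Asymptotics *)

From mathcomp Require Import all_classical all_reals all_analysis.
Import Order.TTheory GRing.Theory Num.Theory.
Import numFieldNormedType.Exports.
Local Open Scope classical_set_scope.
Local Open Scope ring_scope.

Section Rational.
Variable R : realType.
Implicit Types a d : {poly R}.

Lemma cvg_inv_natr : (n%:R^-1 : R) @[n --> \oo] --> 0.
Proof.
rewrite -(cvg_shiftS (fun n => n%:R^-1 : R)); exact: cvg_harmonic.
Qed.

Lemma cvg_horner_inv a : a.[(n%:R^-1 : R)] @[n --> \oo] --> a.[0].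
Proof.
apply: (cvg_comp _ _ cvg_inv_natr); exact: continuous_horner.
Qed.

(** The form in which polynomials in [1/n] are compared: the bound at infinity
comes from the continuity of [a / d] at 0. *)
Lemma rational_bounded a d : d.[0] != 0 ->
  exists2 K : R, 0 < K & \forall n \near \oo,
    [/\ (0 < n)%N, d.[n%:R^-1] != 0 & `|a.[n%:R^-1] / d.[n%:R^-1]| <= K].
Proof.
move=> d0.
have cd : d.[n%:R^-1] @[n --> \oo] --> d.[0] by exact: cvg_horner_inv.
have cad : a.[n%:R^-1] / d.[n%:R^-1] @[n --> \oo] --> a.[0] / d.[0].
  by apply: cvgM; [exact: cvg_horner_inv|exact: cvgV].
exists (`|a.[0] / d.[0]| + 1); first by rewrite ltr_wpDl.
have near_d := cvgr_neq0 _ cd d0.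
have near_ad := cvgr_norm_le _ cad _ (ltr_pwDr ltr01 (lexx _)).
by near=> n; split; near: n; [exact: nbhs_infty_gt|exact: near_d|exact: near_ad].
Unshelve. all: by end_near. Qed.

End Rational.

Theorem proposition3p4 (R : realType) (k : nat) (D : {set setpart k}) :
  [/\ \forall n \near \oo, gram R D n \in unitmx,
      forall p q : subposet D,
        (fun n => weingarten R n p q) =O_\oo
          (fun n => n%:R ^ ((nblocks (val p `|` val q)%O)%:Z
                            - (nblocks (val p))%:Z - (nblocks (val q))%:Z) : R)
    & forall p q : subposet D, (p <= q)%O ->
        (fun n => n%:R ^+ nblocks (val p) * weingarten R n p q)
          = (fun=> (moebius p q)%:~R) +O_\oo (fun n => n%:R^-1 : R)].
Proof.
split=> [|p q|p q _].
- have [K _ dK] := rational_bounded 0 (det_scaled_gram_neq0 R (admissible0 (D := D))).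
  apply: filterS dK => n [n0 dn0 _].
  by have [] := weingartenE (@admissible0 _ D) n0 dn0.
- pose phi := fun p : subposet D => nblocks (val p `|` val q)%O.
  have phiP : admissible phi := admissible_join q.
  have [K K0 dK] := rational_bounded
    (\adj (scaled_gram R phi) (enum_rank p) (enum_rank q))
    (det_scaled_gram_neq0 R phiP).
  apply/eqO_exP; exists K => //; apply: filterS dK => n [n0 dn0 le_K].
  have [_ ->] := weingartenE phiP n0 dn0.
  have n0' : n%:R != 0 :> R by rewrite pnatr_eq0 -lt0n.
  (* This turns the factor [n ^ - phi q] of [weingartenE] into [n ^ - b q]. *)
  have phiq : phi q = nblocks (val q) by rewrite /phi joinxx.
  rewrite phiq normrM !expfzDr // -!exprnN -exprnP.
  by rewrite mulrC ler_wpM2r.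
- pose phi := fun p : subposet D => 0%N.
  have phiP : admissible phi := @admissible0 _ D.
  set a := \adj (scaled_gram R phi) (enum_rank p) (enum_rank q).
  set d := \det (scaled_gram R phi).
  have d0 : d.[0] != 0 := det_scaled_gram_neq0 R phiP.
  (* The difference vanishes at [t = 0]; its factor ['X] yields the O(1/n). *)
  have /factor_theorem[b bE] : root (a - (moebius p q)%:~R%:P * d) 0.
    by rewrite /root !hornerE adj_scaled_gram0_eval subrr.
  have [K K0 dK] := rational_bounded b d0.
  apply/eqaddOP/bigO_exP; exists K => //; apply: filterS dK => n [n0 dn0 le_K].
  have n0' : n%:R != 0 :> R by rewrite pnatr_eq0 -lt0n.
  rewrite !fctE; have [_ ->] := weingartenE phiP n0 dn0.
  rewrite -/a -/d !expr0 divr1 div1r mulrA mulfV ?expf_neq0 // mul1r.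
  have tE : a.[n%:R^-1] = (moebius p q)%:~R * d.[n%:R^-1] + b.[n%:R^-1] / n%:R.
    apply/eqP; rewrite addrC -subr_eq; apply/eqP.
    by have := congr1 (horner^~ n%:R^-1) bE; rewrite !hornerE subr0.
  rewrite tE mulrDl mulfK // addrC addKr mulrAC normrM.
  by rewrite ler_wpM2r.
Qed.
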